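(* Let $T$ be a complete first-order theory and let $\Delta(x,y)$ be a set of formulas over $\emptyset$. Suppose that for every formula $\varphi(x,y) \in \Delta$ there is a formula $\theta_\varphi(x,z)$ such that for every $M \models T$, every finite $\varphi$-type $r(x)$ over $M$ and every finite set $A \subseteq M^{x}$ of realizations of $r$, there is some $b \in M^{z}$ such that $M \models \theta_\varphi(a,b)$ for all $a \in A$ and $\theta_\varphi(x,b) \vdash r(x)$. Then $T$ has singular compactness for $\Delta$: whenever $M \models T$ is $\mu$-saturated for a singular cardinal $\mu > |T|$, every $\Delta$-type $p$ over a set $A \subseteq M$ with $|A| \leq \mu$ is realized in $M$.
   Context: A (partial) $\Delta$-type is a consistent set of (positive) instances $\varphi(x,c)$ of formulas $\varphi(x,y)$ from $\Delta$; a $\varphi$-type is a $\{\varphi\}$-type, i.e. a consistent set of positive instances of $\varphi$ (instances of $\neg\varphi$ are not included). $M^{x}$ denotes the set of tuples from $M$ of the length of $x$. $|T|$ is the (infinite) number of formulas of the language of $T$. *)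

(* Defs.v *)
From mathcomp Require Import all_boot.
From mathcomp Require Import boolp classical_sets functions cardinality wochoice.

Set Implicit Arguments.
Unset Strict Implicit.
Unset Printing Implicit Defensive.

Local Open Scope classical_set_scope.
Local Open Scope card_scope.

Record language := Language {
  fsym : Type;
  farity : fsym -> nat;
  rsym : Type;
  rarity : rsym -> nat }.

(* The free variables of a term or formula are drawn from the type V. *)
Inductive term (L : language) (V : Type) : Type :=
| Var (x : V)
| App (f : fsym L) (t : 'I_(farity f) -> term L V).

(* The quantifier binds the variable None; Some x is the free variable x. *)
Inductive formula (L : language) (V : Type) : Type :=
| Fals
| Eq (s t : term L V)
| Rel (r : rsym L) (t : 'I_(rarity r) -> term L V)
| Imp (p q : formula L V)
| All (p : formula L (option V)).

Arguments Fals {L V}.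

Definition Neg (L : language) (V : Type) (p : formula L V) : formula L V :=
  Imp p Fals.

Record structure (L : language) := Structure {
  carrier :> Type;
  carrier_inhabited : inhabited carrier;
  finterp : forall f : fsym L, ('I_(farity f) -> carrier) -> carrier;
  rinterp : forall r : rsym L, ('I_(rarity r) -> carrier) -> Prop }.

Fixpoint eval (L : language) (M : structure L) (V : Type) (v : V -> M)
    (t : term L V) : M :=
  match t with
  | Var x => v x
  | App f u => finterp (fun i => eval v (u i))
  end.

Fixpoint sat (L : language) (M : structure L) (V : Type) (p : formula L V) :
    (V -> M) -> Prop :=
  match p with
  | Fals => fun _ => False
  | Eq s t => fun v => eval v s = eval v t
  | Rel r t => fun v => rinterp (fun i => eval v (t i))
  | Imp p q => fun v => sat p v -> sat q v
  | All p => fun v => forall a : M, sat p (oapp v a)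
  end.

Definition sentence (L : language) := formula L void.

Definition models (L : language) (M : structure L) (T : set (sentence L)) :=
  forall s, T s -> sat s (of_void M).

Definition theory_entails (L : language) (T : set (sentence L))
    (s : sentence L) :=
  forall M : structure L, models M T -> sat s (of_void M).

Definition complete_theory (L : language) (T : set (sentence L)) :=
  (exists M : structure L, models M T) /\
  forall s, theory_entails T s \/ theory_entails T (Neg s).

Definition elementary (L : language) (M N : structure L) (f : M -> N) :=
  forall (V : Type) (p : formula L V) (v : V -> M),
    sat p v <-> sat p (f \o v).

(* A formula phi(x, y) over the empty set, where x is an n-tuple of variables
   and y is a finite tuple of variables whose length is part of the data. *)
Record pformula (L : language) (n : nat) := PFormula {
  plen : nat;
  pform : formula L ('I_n + 'I_plen) }.

Definition psat (L : language) (n : nat) (M : structure L) (p : pformula L n)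
    (a : 'I_n -> M) (b : 'I_(plen p) -> M) : Prop :=
  sat (pform p) (fun v => match v with inl i => a i | inr j => b j end).

Arguments psat {L n M} p a b.

(* The formula phi(x, c): a pair of phi(x, y) and of a tuple c from M. *)
Definition instance (L : language) (n : nat) (M : structure L) :=
  {p : pformula L n & 'I_(plen p) -> M}.

Definition Inst (L : language) (n : nat) (M : structure L) (p : pformula L n)
    (c : 'I_(plen p) -> M) : instance n M :=
  existT (fun q : pformula L n => 'I_(plen q) -> M) p c.

Arguments Inst {L n M} p c.

Definition realizes_along (L : language) (n : nat) (M N : structure L)
    (f : M -> N) (a : 'I_n -> N) (r : set (instance n M)) :=
  forall i, r i -> psat (tag i) a (f \o tagged i).

Definition realizes (L : language) (n : nat) (M : structure L)
    (a : 'I_n -> M) (r : set (instance n M)) :=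
  realizes_along id a r.

(* Consistency and consequence are modulo the elementary diagram of M. *)
Definition consistent (L : language) (n : nat) (M : structure L)
    (r : set (instance n M)) :=
  exists (N : structure L) (f : M -> N) (a : 'I_n -> N),
    elementary f /\ realizes_along f a r.

Definition entails (L : language) (n : nat) (M : structure L)
    (q r : set (instance n M)) :=
  forall (N : structure L) (f : M -> N) (a : 'I_n -> N),
    elementary f -> realizes_along f a q -> realizes_along f a r.

Definition is_type (L : language) (n : nat) (Delta : set (pformula L n))
    (M : structure L) (A : set M) (r : set (instance n M)) :=
  (forall i, r i -> Delta (tag i) /\ forall j, A (tagged i j)) /\ consistent r.

Definition card_lt (X Y : Type) (A : set X) (B : set Y) : Prop :=
  (A #<= B) /\ ~ (B #<= A).

(* A cardinal is an initial ordinal: a well-ordered type all of whose proper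
   initial segments have strictly smaller cardinality. *)
Record cardinal := Cardinal {
  points :> Type;
  cle : rel points;
  cle_wo : well_order cle;
  cle_initial :
    forall k : points, card_lt [set j : points | ~~ cle k j] [set: points] }.

(* The cofinality is the least cardinality of a cofinal subset. *)
Definition singular (mu : cardinal) :=
  infinite_set [set: mu] /\
  exists C : set mu,
    (forall k : mu, exists2 c, C c & cle k c) /\ card_lt C [set: mu].

Definition saturated (L : language) (mu : cardinal) (M : structure L) :=
  forall (n : nat) (A : set M) (r : set (instance n M)),
    card_lt A [set: mu] -> is_type [set: pformula L n] A r ->
    exists a : 'I_n -> M, realizes a r.

(* |T| is the number of formulas in the variables v_0, v_1, v_2 and so on. *)
Definition singular_compactness (L : language) (T : set (sentence L))
    (n : nat) (Delta : set (pformula L n)) :=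
  forall (M : structure L) (mu : cardinal),
    models M T -> singular mu ->
    card_lt [set: formula L nat] [set: mu] -> saturated mu M ->
    forall (A : set M) (p : set (instance n M)),
      A #<= [set: mu] -> is_type Delta A p ->
      exists a : 'I_n -> M, realizes a p.

(* Main.v *)
From Stdlib Require List.
Require Import Defs.
From mathcomp Require Import all_boot.
From mathcomp Require Import boolp classical_sets functions cardinality.
From mathcomp Require Import wochoice filter.

Set Implicit Arguments.
Unset Strict Implicit.
Unset Printing Implicit Defensive.

Local Open Scope classical_set_scope.
Local Open Scope card_scope.

(** Write A as an increasing union of sets A_k (k in mu) of size < mu and let C
    be a cofinal subset of mu of size < mu. By saturation the restriction p_k
    of p to A_k has a realization a_k. For phi in Delta and k in C, the
    conditions "theta_phi(a_j, z) for all j >= k in C" and "theta_phi(x, z)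
    implies phi(x, c) for all phi(x, c) in p_k" on z involve fewer than mu
    parameters and are finitely satisfiable by hypothesis, so some b_(phi, k)
    in M satisfies them all. The set of all theta_phi(x, b_(phi, k)) has at
    most |T| |C| < mu parameters, it is finitely satisfied by the a_j, and a
    realization of it in M realizes p.
    Passing from finite satisfiability in M to consistency is the compactness
    theorem, obtained from an ultrapower of M; the parameter counts need that
    an infinite set is equipotent with its square. *)

(** * Cardinal arithmetic *)

(** Choice turns [R] into a function, injective by the second condition, so a bound needs only a
    relation and no map between subtypes. *)
Lemma card_le_rel (T U : Type) (A : set T) (B : set U) (R : T -> U -> Prop) :
  (forall x, A x -> exists2 y, B y & R x y) ->
  (forall x x' y, A x -> A x' -> R x y -> R x' y -> x = x') ->
  A #<= B.
Proof.
move=> Rtot Rinj; have /choice[f fR] (x : A) : exists y : B, R (val x) (val y).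
  have [y By Rxy] := Rtot _ (set_valP x).
  by exists (SigSub (mem_set By)).
apply/card_leP/injfunPex; exists f => // x y _ _ fxy.
apply: val_inj; apply: (Rinj _ _ (val (f x))); rewrite ?fxy //; try exact: set_valP.
by rewrite -fxy.
Qed.

(** Trades a map between subtypes for one on the ambient types; [u] is its value outside [A]. *)
Lemma card_le_exfun (T U : Type) (u : U) (A : set T) (B : set U) :
  A #<= B ->
  exists f : T -> U, (forall x, A x -> B (f x)) /\
    (forall x y, A x -> A y -> f x = f y -> x = y).
Proof.
move=> /card_leP/injfunPex[f _ finj].
exists (fun x => if pselect (A x) is left Ax then val (f (SigSub (mem_set Ax)))
                 else u); split=> [x Ax|x y Ax Ay].
  by case: pselect => // ?; exact: set_valP.
case: pselect => // Ax'; case: pselect => // Ay' /val_inj/finj.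
by rewrite !inE => /(_ I I)[].
Qed.

Lemma chain_bigcup2 (T : Type) (F : set (set T)) (p q : T) :
  total_on F subset -> (\bigcup_(X in F) X) p -> (\bigcup_(X in F) X) q ->
  exists X, [/\ F X, X p & X q].
Proof.
move=> Ftot [X FX Xp] [Y FY Yq].
by have [/(_ _ Xp)|/(_ _ Yq)] := Ftot _ _ FX FY; [exists Y|exists X].
Qed.

(** Zorn's lemma gives a maximal graph of a partial injection from [A] to [B]; it is defined on all
    of [A] or covers [B]. *)
Lemma card_le_total (T U : Type) (A : set T) (B : set U) :
  A #<= B \/ B #<= A.
Proof.
pose P (G : set (T * U)) := [/\ G `<=` A `*` B,
  forall x y y', G (x, y) -> G (x, y') -> y = y' &
  forall x x' y, G (x, y) -> G (x', y) -> x = x'].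
have [F FP Ftot|G [[GAB Gfun Ginj] Gmax]] := @Zorn_bigcup _ P.
  split=> [p [X /FP[XAB _ _] /XAB]//|x y y' Gp Gq|x x' y Gp Gq].
    by have [X [/FP[_ Xfun _] Xp Xq]] := chain_bigcup2 Ftot Gp Gq; exact: Xfun Xp Xq.
  by have [X [/FP[_ _ Xinj] Xp Xq]] := chain_bigcup2 Ftot Gp Gq; exact: Xinj Xp Xq.
have [Gtot|/existsNP[x0 /not_implyP[Ax0 /forallNP Gx0]]] :=
    pselect (forall x, A x -> exists y, G (x, y)).
  left; apply: (@card_le_rel _ _ _ _ (fun x y => G (x, y))).
    by move=> x /Gtot[y Gxy]; exists y => //; have [] := GAB _ Gxy.
  by move=> x x' y _ _; exact: Ginj.
right; apply: (@card_le_rel _ _ _ _ (fun y x => G (x, y))); last first.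
  by move=> y y' x _ _; exact: Gfun.
move=> y0 By0; apply: contrapT => Gy0.
have {}Gy0 x : ~ G (x, y0).
  by move=> Gxy; apply: Gy0; exists x => //; have [] := GAB _ Gxy.
apply: (Gmax (G `|` [set (x0, y0)])).
  split; first exact: subsetUl.
  by move=> /(_ (x0, y0) (or_intror erefl))/Gx0.
split.
- by move=> p [/GAB//|->].
- move=> x y y' [Gxy|[-> ->]] [Gxy'|]; first exact: Gfun Gxy Gxy'.
  + by case=> ex _; rewrite ex in Gxy; case: (Gx0 _ Gxy).
  + by case: (Gx0 _ Gxy').
  + by case.
- move=> x x' y [Gxy|[-> ->]] [Gxy'|]; first exact: Ginj Gxy Gxy'.
  + by case=> _ ey; rewrite ey in Gxy; case: (Gy0 _ Gxy).
  + by case: (Gy0 _ Gxy').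
  + by case.
Qed.

Lemma card_le_setX (T T' U U' : Type) (A : set T) (A' : set T') (B : set U)
    (B' : set U') :
  A #<= B -> A' #<= B' -> A `*` A' #<= B `*` B'.
Proof.
move=> /card_leP/injfunPex[f _ finj] /card_leP/injfunPex[g _ ginj].
apply: (@card_le_rel _ _ _ _ (fun x y =>
   exists a a', [/\ val a = x.1, val a' = x.2, val (f a) = y.1 & val (g a') = y.2])).
  move=> [x x'] [/= Ax Ax']; pose a : A := SigSub (mem_set Ax).
  pose a' : A' := SigSub (mem_set Ax').
  exists (val (f a), val (g a')); first by split; exact: set_valP.
  by exists a, a'.
move=> [x x'] [y y'] [z z'] _ _ /= [a [a' [<- <- <- <-]]] [b [b' [<- <- ]]].
by move=> /val_inj/finj-> ; rewrite ?inE // => /val_inj/ginj->; rewrite ?inE.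
Qed.

(* Zorn's lemma on (graphs of) injections from S x S into S. If S embeds by g
   into its complement, the pairing extends to the union of S and g(S): the new
   pairs are sent into g(S), tagged by which of their components lie in g(S). *)
Lemma maximal_pairing (X : Type) : infinite_set [set: X] ->
  exists S (f : X -> X -> X) (e : nat -> X),
    [/\ forall x y, S x -> S y -> S (f x y),
        forall x y x' y', S x -> S y -> S x' -> S y' -> f x y = f x' y' ->
          x = x' /\ y = y',
        injective e /\ (forall i, S (e i)) & ~ (S #<= ~` S)].
Proof.
move=> /infiniteP; case/card_leP/injfunPex => e0 _ e0inj.
pose e i : X := val (e0 (SigSub (mem_set (I : [set: nat] i)))).
have einj : injective e.
  by move=> i j /val_inj/e0inj; rewrite !inE => /(_ I I)[].
pose h : nat * nat -> nat := pickle; have hinj : injective h := pcan_inj pickleK.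
pose G0 : set (X * X * X) := [set q | exists i j, q = (e i, e j, e (h (i, j)))].
pose dom (G : set (X * X * X)) x := exists z, G (x, x, z).
(* Zorn's lemma includes the empty chain, so the empty graph has to satisfy [P]; hence the last
   clause concerns nonempty graphs only. *)
pose P (G : set (X * X * X)) :=
  [/\ forall p z z', G (p, z) -> G (p, z') -> z = z',
      forall p q z, G (p, z) -> G (q, z) -> p = q,
      forall x y z, G (x, y, z) -> [/\ dom G x, dom G y & dom G z],
      forall x y, dom G x -> dom G y -> exists z, G (x, y, z) &
      G !=set0 -> G0 `<=` G].
have domS G G' x : G `<=` G' -> dom G x -> dom G' x.
  by move=> GG' [z Gz]; exists z; exact: GG'.
have PG0 : P G0.
  have dom0 i : dom G0 (e i) by exists (e (h (i, i))), i, i.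
  split=> //.
  - by move=> p z z' [i [j [-> ->]]] [i' [j' [/einj <- /einj <- ->]]].
  - by move=> p q z [i [j [-> ->]]] [i' [j' [-> /einj/hinj[<- <-]]]].
  - by move=> x y z [i [j [-> -> ->]]].
  - move=> x y [z [i [_ [-> _ _]]]] [z' [j [_ [-> _ _]]]].
    by exists (e (h (i, j))), i, j.
  - by move=> _ q.
have [F FP Ftot|G [[Gfun Ginj Gdom Gtot GG0] Gmax]] := @Zorn_bigcup _ P.
  have up Y : F Y -> Y `<=` \bigcup_(X in F) X by move=> FY p Yp; exists Y.
  split.
  - move=> p z z' Gp Gq; have [Y [/FP[Yfun _ _ _ _] Yp Yq]] := chain_bigcup2 Ftot Gp Gq.
    exact: Yfun Yp Yq.
  - move=> p q z Gp Gq; have [Y [/FP[_ Yinj _ _ _] Yp Yq]] := chain_bigcup2 Ftot Gp Gq.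
    exact: Yinj Yp Yq.
  - move=> x y z [Y FY Yp]; have [_ _ Ydom _ _] := FP _ FY.
    by have [? ? ?] := Ydom _ _ _ Yp; split; apply: domS (up _ FY) _.
  - move=> x y [z Gx] [z' Gy].
    have [Y [FY Yx Yy]] := chain_bigcup2 Ftot Gx Gy.
    have [_ _ _ Ytot _] := FP _ FY.
    have [w Yw] := Ytot x y (ex_intro _ z Yx) (ex_intro _ z' Yy).
    by exists w, Y.
  - move=> [p [Y FY Yp]]; have [_ _ _ _ YG0] := FP _ FY.
    by apply: subset_trans (up _ FY); apply: YG0; exists p.
(* Otherwise [G] is empty and [G0] properly extends it. *)
have {}GG0 : G0 `<=` G.
  apply: contrapT => nGG0; case: (Gmax G0) => //; split=> // p Gp.
  by case: nGG0; apply: GG0; exists p.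
pose S := dom G.
have Se i : S (e i) by exists (e (h (i, i))); apply: GG0; exists i, i.
have /choice[f fP] (p : X * X) : exists z, S p.1 -> S p.2 -> G (p, z).
  have [[S1 S2]|nS] := pselect (S p.1 /\ S p.2).
    by have [z Gz] := Gtot _ _ S1 S2; exists z => _ _; case: p S1 S2 Gz.
  by exists (e 0) => S1 S2; case: nS.
have fS x y : S x -> S y -> S (f (x, y)).
  by move=> Sx Sy; have [] := Gdom _ _ _ (fP (x, y) Sx Sy).
have finj x y x' y' : S x -> S y -> S x' -> S y' -> f (x, y) = f (x', y') ->
    x = x' /\ y = y'.
  move=> Sx Sy Sx' Sy' ff.
  have := fP (x, y) Sx Sy; rewrite ff => /Ginj/(_ (fP (x', y') Sx' Sy')).
  by case.
exists S, (fun x y => f (x, y)), e; split=> //.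
move=> /(card_le_exfun (e 0))[g [gS ginj]].
(* On [S], [u false] is the identity and [u true] the copy outside [S]; the [c b b'] are four
   distinct tags in [S]. *)
pose u (b : bool) x := if b then g x else x.
pose c (b b' : bool) := e (b + b'.*2).
have cinj b1 b1' b2 b2' : c b1 b1' = c b2 b2' -> b1 = b2 /\ b1' = b2'.
  by move/einj; case: b1 b1' b2 b2' => [] [] [] [].
have uinj b b' x x' : S x -> S x' -> u b x = u b' x' -> b = b' /\ x = x'.
  case: b b' => [] [] /= Sx Sx'; first by move=> /ginj->.
  - by move=> gx; case: (gS _ Sx); rewrite gx.
  - by move=> gx; case: (gS _ Sx'); rewrite -gx.
  - by [].
have Sc b b' : S (c b b') by exact: Se.
(* Tag and pair are encoded inside [S] by [f], then moved out of [S] by [g], so new values never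
   meet old ones. *)
pose v b b' s t := g (f (c b b', f (s, t))).
pose G' : set (X * X * X) := [set q | exists b b' s t,
   [/\ b || b', S s, S t & q = (u b s, u b' t, v b b' s t)]].
have uS b s : S s -> S (u b s) -> b = false.
  by case: b => //= Ss; have := gS _ Ss.
have GG' p z z' : G (p, z) -> ~ G' (p, z').
  case: p => x y /Gdom[Sx Sy _] [b [b' [s [t [+ Ss St []]]]]] ? ? _; subst.
  by rewrite (uS b s) // (uS b' t).
have vS b b' s t : S s -> S t -> ~ S (v b b' s t).
  by move=> Ss St; apply/gS/fS => //; exact: fS.
have vinj b b' s t b1 b1' s1 t1 : S s -> S t -> S s1 -> S t1 ->
    v b b' s t = v b1 b1' s1 t1 -> [/\ b = b1, b' = b1', s = s1 & t = t1].
  move=> Ss St Ss1 St1 vv.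
  have [] : c b b' = c b1 b1' /\ f (s, t) = f (s1, t1).
    by apply: (finj _ _ _ _ _ _ _ _ (ginj _ _ _ _ vv)); [|exact: fS| |exact: fS
      |apply: (fS); [|exact: fS]|apply: (fS); [|exact: fS]].
  by move=> /cinj[-> ->] /finj[] // -> ->.
have domU b s : S s -> dom (G `|` G') (u b s).
  move=> Ss; case: b.
    by exists (v true true s s); right; exists true, true, s, s.
  exact: domS (@subsetUl _ _ _) _.
have domUE x : dom (G `|` G') x -> exists b s, S s /\ x = u b s.
  move=> [z [Gx|[b [b' [s [t [_ Ss _ [-> _ _]]]]]]]].
    by exists false, x; split=> //; exists z.
  by exists b, s.
apply: (Gmax (G `|` G')); first split; first exact: subsetUl.
  move=> G'G; have : G (u true (e 0), u false (e 0), v true false (e 0) (e 0)).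
    by apply: G'G; right; exists true, false, (e 0), (e 0).
  by move=> /Gdom[/(uS _ _ (Se 0))].
split.
- move=> p z z' [Gp|Gp] [Gq|Gq]; [exact: Gfun Gp Gq|..].
  + by case: (GG' _ _ _ Gp Gq).
  + by case: (GG' _ _ _ Gq Gp).
  + case: Gp Gq => b [b' [s [t [_ Ss St [-> ->]]]]] [b1 [b1' [s1 [t1 [_ Ss1 St1]]]]].
    by case=> /uinj[]// -> -> /uinj[]// -> -> ->.
- move=> p q z [Gp|Gp] [Gq|Gq]; [exact: Ginj Gp Gq|..].
  + case: p Gp => x y /Gdom[_ _ Sz]; case: Gq => b [b' [s [t [_ Ss St [_ ez]]]]].
    by case: (@vS b b' s t) => //; rewrite -ez.
  + case: q Gq => x y /Gdom[_ _ Sz]; case: Gp => b [b' [s [t [_ Ss St [_ ez]]]]].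
    by case: (@vS b b' s t) => //; rewrite -ez.
  + case: Gp Gq => b [b' [s [t [_ Ss St [-> ->]]]]] [b1 [b1' [s1 [t1 [_ Ss1 St1]]]]].
    by case=> -> /vinj[]// -> -> -> ->.
- move=> x y z [Gp|[b [b' [s [t [_ Ss St [-> -> ->]]]]]]].
    by have [? ? ?] := Gdom _ _ _ Gp; split; apply: domS (@subsetUl _ _ _) _.
  split; [exact: domU|exact: domU|].
  by apply: (domU true); apply: (fS) => //; exact: fS.
- move=> x y /domUE[b [s [Ss ->]]] /domUE[b' [t [St ->]]].
  have [bb|] := boolP (b || b').
    by exists (v b b' s t); right; exists b, b', s, t.
  rewrite negb_or => /andP[/negPf-> /negPf->].
  by exists (f (s, t)); left; exact: fP.
- by move=> _; apply: subset_trans GG0 _; exact: subsetUl.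
Qed.

(** The set [S] of [maximal_pairing] does not embed in its complement. By comparability the
    complement embeds in [S], hence so does the whole of [A], and the pairing on [S] applies. *)
Lemma card_le_setX_infinite (X : Type) (A : set X) :
  infinite_set A -> A `*` A #<= A.
Proof.
move=> Ainf; have A'inf : infinite_set [set: A].
  by apply: contra_not Ainf; apply: card_le_finite; by rewrite (card_le_eqr (card_setT A)).
have [S [f [e [fS finj [einj eS] nS]]]] := maximal_pairing A'inf.
have [//|/(card_le_exfun (e 0))[k [kS kinj]]] := card_le_total S (~` S).
(* The tags [e 0] and [e 1] keep the images of [S] and of its complement apart. *)
pose w x := if pselect (S x) is left _ then f (e 0) x else f (e 1) (k x).
have wS x : S (w x) by rewrite /w; case: pselect => Sx; apply: (fS) => //; exact: kS.
have winj x y : w x = w y -> x = y.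
  rewrite /w; case: pselect => Sx; case: pselect => Sy /finj[]//; try exact: kS.
  - by move=> /einj.
  - by move=> /einj.
  - by move=> _ /kinj->.
have AX : A `*` A #<= [set: A] `*` [set: A].
  by apply: card_le_setX; rewrite (card_le_eqr (card_setT _)).
apply: card_le_trans AX _; rewrite -(card_le_eqr (card_setT _)).
apply: (@card_le_rel _ _ _ _ (fun p z => z = f (w p.1) (w p.2))).
  by move=> p _; exists (f (w p.1) (w p.2)).
by move=> [x y] [x' y'] z _ _ /= -> /finj[]// /winj-> /winj->.
Qed.

(** * Strict comparison of cardinalities *)

Lemma card_lt_le_trans (T U V : Type) (A : set T) (B : set U) (C : set V) :
  A #<= B -> card_lt B C -> card_lt A C.
Proof.
move=> AB [BC nCB]; split; first exact: card_le_trans AB BC.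
by move=> CA; apply: nCB; exact: card_le_trans CA AB.
Qed.

Lemma card_lt_finite (T U : Type) (A : set T) (B : set U) :
  finite_set A -> infinite_set B -> card_lt A B.
Proof.
move=> Afin Binf; have [|BA] := card_le_total A B; last first.
  by case: Binf; exact: card_le_finite BA Afin.
by move=> AB; split=> // BA; apply: Binf; exact: card_le_finite BA Afin.
Qed.

(** The product embeds in the square of the larger factor, which is finite or no larger than that
    factor. *)
Lemma card_lt_setX (T U V : Type) (A : set T) (B : set U) (K : set V) :
  infinite_set K -> card_lt A K -> card_lt B K -> card_lt (A `*` B) K.
Proof.
move=> Kinf AK BK.
have sq W (C : set W) : card_lt C K -> card_lt (C `*` C) K.
  move=> CK; have [Cfin|Cinf] := pselect (finite_set C).
    by apply: card_lt_finite => //; exact: finite_setX.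
  exact: card_lt_le_trans (card_le_setX_infinite Cinf) CK.
have [AB|BA] := card_le_total A B.
  exact: card_lt_le_trans (card_le_setX AB (card_lexx _)) (sq _ _ BK).
exact: card_lt_le_trans (card_le_setX (card_lexx _) BA) (sq _ _ AK).
Qed.

(** The union embeds in two copies of the larger set. *)
Lemma card_lt_setU (T V : Type) (A B : set T) (K : set V) :
  infinite_set K -> card_lt A K -> card_lt B K -> card_lt (A `|` B) K.
Proof.
move=> Kinf AK BK.
wlog AB : A B AK BK / A #<= B.
  move=> hwlog; have [AB|BA] := card_le_total A B; first exact: hwlog.
  by rewrite setUC; exact: hwlog.
have bK : card_lt ([set: bool] `*` B) K.
  by apply: card_lt_setX => //; exact: card_lt_finite.
apply: card_lt_le_trans bK; move: AB => /card_leP/injfunPex[f _ finj].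
apply: (@card_le_rel _ _ _ _ (fun x p => if p.1
    then exists2 a : A, val a = x & val (f a) = p.2 else B x /\ x = p.2)).
  move=> x [Ax|Bx]; last by exists (false, x).
  pose a : A := SigSub (mem_set Ax).
  by exists (true, val (f a)); [split=> //; exact: set_valP|exists a].
move=> x x' [[] y] _ _ /=; last by move=> [_ ->] [_ ->].
by move=> [a <- <-] [a' <- /val_inj/finj->]; rewrite ?inE.
Qed.

(** * Order properties of well-orders *)

Section WellOrder.
Variables (T : Type) (R : rel T).
Hypothesis Rwo : well_order R.

Let minP (P : T -> Prop) : (exists x, P x) ->
  exists2 z, P z & forall x, P x -> R z x.
Proof.
move=> [x Px]; have [|z [[]]] := Rwo (A := fun x => `[< P x >]).
  by exists x; exact/asboolP.
move=> /asboolP Pz minz _; exists z => // y Py.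
by apply: minz; exact/asboolP.
Qed.

Lemma well_order_total : total R.
Proof.
move=> x y; have [|z] := minP (P := fun z => z = x \/ z = y).
  by exists x; left.
by move=> [->|->] minz; rewrite minz ?orbT //; [right|left].
Qed.

(** Both points are least in the pair they form, and [well_order] makes least elements unique. *)
Lemma well_order_anti : antisymmetric R.
Proof.
move=> x y /andP[xy yx]; pose P z := `[< z = x \/ z = y >].
have Rxx z : R z z by have := well_order_total z z; rewrite orbb.
have [|z [_ zU]] := Rwo (A := P); first by exists x; apply/asboolP; left.
have <- : z = x.
  by apply: zU; split; [apply/asboolP; left|move=> t /asboolP[->|->]].
by apply: zU; split; [apply/asboolP; right|move=> t /asboolP[->|->]].
Qed.

Lemma well_order_trans : transitive R.
Proof.
move=> y x z xy yz.
have [|m] := minP (P := fun t => [\/ t = x, t = y | t = z]).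
  by exists x; constructor 1.
case=> -> minm; first by apply: minm; constructor 3.
  by have -> : x = y by apply: well_order_anti; rewrite xy minm //; constructor 1.
by have <- : y = z by apply: well_order_anti; rewrite yz minm //; constructor 2.
Qed.

End WellOrder.

(** * Ultrapowers and compactness *)

Section Ultrapower.
Variables (L : language) (M : structure L) (I : Type) (U : set_system I).
Hypothesis UU : UltraFilter U.

Let UF : Filter U. Proof. exact: filter_filter. Qed.

Definition ultra_class (f : I -> M) : set (I -> M) :=
  [set g | U [set i | f i = g i]].

(** Elements are the classes themselves, since [Eq] is interpreted by plain equality. *)
Definition ultrapower_carrier := {S : set (I -> M) | exists f, S = ultra_class f}.

Definition ultra (f : I -> M) : ultrapower_carrier :=
  exist _ (ultra_class f) (ex_intro _ f erefl).

Definition ultra_repr (x : ultrapower_carrier) : I -> M := sval (cid (svalP x)).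

Lemma ultra_reprK x : ultra (ultra_repr x) = x.
Proof.
by rewrite /ultra_repr; case: cid => f; case: x => S ? /= Sf; exact/eq_exist/esym.
Qed.

Lemma eq_ultraP f g : ultra f = ultra g <-> U [set i | f i = g i].
Proof.
split=> [/(congr1 sval)/= fg|Ufg].
  have : ultra_class g g by apply: filterS filterT => i.
  by rewrite -fg.
apply/eq_exist/seteqP; split=> h Uh; apply: filterS (filterI Ufg Uh) => i [].
  by move=> /= ->.
by move=> /= <- <-.
Qed.

Lemma ultra_reprP f : U [set i | f i = ultra_repr (ultra f) i].
Proof. by apply/eq_ultraP; rewrite ultra_reprK. Qed.

(** Symbols are interpreted on chosen representatives; by [ultra_reprP] these agree with any others
    on a set of [U]. *)
Definition ultrapower : structure L := {|
  carrier := ultrapower_carrier;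
  carrier_inhabited :=
    let: inhabits x := carrier_inhabited M in inhabits (ultra (fun=> x));
  finterp f t := ultra (fun i => finterp (fun k => ultra_repr (t k) i));
  rinterp r t := U [set i | rinterp (fun k => ultra_repr (t k) i)] |}.

(** Arities are finite, so the sets of [U] on which the representatives of the arguments agree can
    be intersected. *)
Lemma eval_ultra (V : Type) (h : V -> I -> M) (t : term L V) :
  @eval L ultrapower V (fun x => ultra (h x)) t =
  ultra (fun i => eval (fun x => h x i) t).
Proof.
elim: t => [x|f u IHu] //=; apply/eq_ultraP.
have := filter_forall UF (fun k => ultra_reprP (fun i => eval (fun x => h x i) (u k))).
apply: filterS => i ui; congr finterp; apply/funext => k.
by rewrite IHu -ui.
Qed.

Lemma filter_congr (A B C : set I) :
  U C -> (forall i, C i -> A i <-> B i) -> U A <-> U B.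
Proof.
move=> UC AB; split=> UX; apply: filterS (filterI UC UX) => i [Ci].
  by case: (AB i Ci); auto.
by case: (AB i Ci); auto.
Qed.

Lemma ultraC (A : set I) : U (~` A) <-> ~ U A.
Proof.
split=> [UnA UA|nUA]; last by have [] := in_ultra_setVsetC A UU.
apply: (@filter_not_empty _ U _); apply: filterS (filterI UA UnA) => i [] //.
Qed.

(** Los's theorem. The family [h] of representatives is arbitrary so that the induction can extend
    it under a quantifier. *)
Lemma los (V : Type) (p : formula L V) (h : V -> I -> M) :
  @sat L ultrapower V p (fun x => ultra (h x)) <->
  U [set i | sat p (fun x => h x i)].
Proof.
elim: p h => {V} [V|V s t|V r t|V p IHp q IHq|V p IHp] h /=.
- split=> // UF0; apply: (@filter_not_empty _ U _); exact: filterS UF0.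
- by rewrite !eval_ultra; exact: eq_ultraP.
- have C := filter_forall UF
    (fun k => ultra_reprP (fun i => eval (fun x => h x i) (t k))).
  apply: (filter_congr C) => i ti.
  rewrite -propeqE; congr rinterp; apply/funext => k.
  by rewrite eval_ultra -ti.
- rewrite IHp IHq; split=> [UpUq|Upq Up]; last first.
    by apply: filterS (filterI Upq Up) => i [pq /pq].
  have [Up|nUp] := pselect (U [set i | sat p (fun x => h x i)]).
    by apply: filterS (UpUq Up) => i /= qi _.
  by move/ultraC : nUp; apply: filterS => i np /np.
- have oappE k i : (fun v => oapp h k v i) = oapp (fun x => h x i) (k i).
    by apply/funext => -[].
  have oappU k : oapp (fun x => ultra (h x)) (ultra k) = fun v => ultra (oapp h k v).
    by apply/funext => -[].
  split=> [satp|Up a]; last first.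
    rewrite -(ultra_reprK a) oappU IHp; apply: filterS Up => i /=.
    by rewrite oappE.
  apply: contrapT => /ultraC nUp.
  (* A counterexample is chosen at each index that has one; the class of [k] then contradicts
     [satp]. *)
  have /choice[k kP] i : exists a, ~ (forall b, sat p (oapp (fun x => h x i) b)) ->
      ~ sat p (oapp (fun x => h x i) a).
    have [[a na]|nn] := pselect (exists a, ~ sat p (oapp (fun x => h x i) a)).
      by exists a.
    case: (carrier_inhabited M) => a; exists a; case=> b.
    by apply: contrapT => nb; apply: nn; exists b.
  have := satp (ultra k); rewrite oappU IHp => Upk.
  apply: (@filter_not_empty _ U _); apply: filterS (filterI nUp Upk) => i /= [/kP].
  by rewrite oappE.
Qed.

(** For constant representatives the set of indices in [los] is everything or empty. *)
Lemma elementary_ultra : @elementary L M ultrapower (fun a => ultra (fun=> a)).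
Proof.
move=> V p v; rewrite (los p (fun x _ => v x)); split=> [pv|].
  by apply: filterS filterT.
by have [//|npv /(filterS (Q := set0))-/(_ (fun _ => npv))/filter_not_empty] :=
  pselect (sat p v).
Qed.

End Ultrapower.

(** The indices are finite lists of instances, under an ultrafilter containing all cones. Each
    instance of [r] then belongs to almost every list, so the class of the tuples chosen for the
    lists realizes [r]. *)
Lemma finitely_satisfiable_consistent (L : language) (n : nat) (M : structure L)
    (r : set (instance n M)) :
  (forall s : seq (instance n M), (forall i, List.In i s -> r i) ->
    exists a : 'I_n -> M, forall i, List.In i s -> psat (tag i) a (tagged i)) ->
  consistent r.
Proof.
move=> rfin; pose I := seq (instance n M).
pose D : set I := [set s | forall i, List.In i s -> r i].
pose cone (s : I) : set I := [set s' | D s' /\ forall i, List.In i s -> List.In i s'].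
have FF : Filter (filter_from D cone).
  apply: filter_from_filter; first by exists [::].
  move=> s s' Ds Ds'; exists (s ++ s').
    by move=> i si; case: (List.in_app_or _ _ _ si); [exact: Ds|exact: Ds'].
  move=> t [Dt tP]; split; split=> // i iP; apply: tP; apply: List.in_or_app.
    by left.
  by right.
have PF : ProperFilter (filter_from D cone).
  by apply: filter_from_proper => s Ds; exists s.
have [U [UU FU]] := ultraFilterLemma PF.
have UF : Filter U by exact: filter_filter.
have UD : U D by apply: FU; exists [::] => // s [].
have Ui i : r i -> U [set s | List.In i s].
  move=> ri; apply: FU; exists [:: i]; first by move=> _ [<-|[]].
  by move=> s [_]; apply; left.
have /choice[w wP] (s : I) : exists a : 'I_n -> M,
    D s -> forall i, List.In i s -> psat (tag i) a (tagged i).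
  have [/rfin[a aP]|nD] := pselect (D s); first by exists a.
  by case: (carrier_inhabited M) => a; exists (fun=> a).
exists (ultrapower M U), (fun a => ultra U (fun=> a)), (fun k => ultra U (w ^~ k)).
split; first exact: elementary_ultra.
move=> i ri; rewrite /psat.
pose h (v : 'I_n + 'I_(plen (tag i))) : I -> M :=
  match v with inl k => w ^~ k | inr j => fun=> tagged i j end.
rewrite (_ : (fun v => _) = fun v => ultra U (h v)); last by apply/funext => -[].
apply/los; apply: filterS (filterI UD (Ui i ri)) => s [Ds si].
have := wP s Ds i si; rewrite /psat.
by rewrite (_ : (fun v => _) = h ^~ s) //; apply/funext => -[].
Qed.

(** * Singular compactness *)

Section Renaming.
Variable L : language.

Fixpoint trename (V W : Type) (f : V -> W) (t : term L V) : term L W :=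
  match t with
  | Var x => Var L (f x)
  | App g u => App (fun i => trename f (u i))
  end.

Fixpoint frename (V W : Type) (f : V -> W) (p : formula L V) : formula L W :=
  match p with
  | Fals => Fals
  | Eq s t => Eq (trename f s) (trename f t)
  | Rel r t => Rel (fun i => trename f (t i))
  | Imp p q => Imp (frename f p) (frename f q)
  | All p => All (frename (omap f) p)
  end.

Lemma eval_trename (M : structure L) (V W : Type) (f : V -> W) (v : W -> M)
    (t : term L V) : eval v (trename f t) = eval (v \o f) t.
Proof. by elim: t => //= g u IHu; congr finterp; apply/funext. Qed.

Lemma sat_frename (M : structure L) (V W : Type) (f : V -> W) (p : formula L V)
    (v : W -> M) : sat (frename f p) v <-> sat p (v \o f).
Proof.
elim: p W f v => {V} [V|V s t|V r t|V p IHp q IHq|V p IHp] W f v //=.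
- by rewrite !eval_trename.
- by rewrite (_ : (fun i => _) = (fun i => eval (v \o f) (t i))) //;
    apply/funext => i; rewrite eval_trename.
- by rewrite IHp IHq.
- have E a : oapp v a \o omap f = oapp (v \o f) a by apply/funext => -[].
  by split=> pa a; have := pa a; rewrite IHp E.
Qed.

(** The structure [{classic T}] supplies the decidable equality that this cancellation rests on. *)
Lemma existT_classic_inj (T : Type) (P : T -> Type) (x : T) (a b : P x) :
  existT P x a = existT P x b -> a = b.
Proof. exact: (@existT_inj2 {classic T} P x a b). Qed.

Lemma trename_inj (V W : Type) (f : V -> W) :
  injective f -> injective (trename f).
Proof.
move=> finj; elim=> [x|g u IHu] [y|g' u'] //= [].
  by move/finj ->.
move=> gg'; case: _ / gg' u' => u' E; have uu' := existT_classic_inj E; congr App.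
by apply/funext => i; apply: IHu; exact: (congr1 (@^~ i) uu').
Qed.

(** Serves the counting of formulas: renaming into [nat] identifies none of them. Under [All],
    [omap f] is again injective. *)
Lemma frename_inj (V W : Type) (f : V -> W) :
  injective f -> injective (frename f).
Proof.
move=> finj p; elim: p W f finj => {V} [V|V s t|V r t|V p IHp q IHq|V p IHp] W f finj.
- by case.
- by case=> //= s' t' [/(trename_inj finj)-> /(trename_inj finj)->].
- case=> //= r' t' [] rr'; case: _ / rr' t' => t' E; have tt' := existT_classic_inj E.
  congr Rel; apply/funext => i; apply: (trename_inj finj).
  exact: (congr1 (@^~ i) tt').
- by case=> //= p' q' [/(IHp _ _ finj)-> /(IHq _ _ finj)->].
- case=> //= p' [] /IHp -> //.
  by move=> [x|] [y|] //= [/finj->].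
Qed.

End Renaming.

(** * Formulas for the conditions on parameters, and their coding *)

Section Formulas.
Variable L : language.

Definition sumv (M V W : Type) (a : V -> M) (b : W -> M) (x : V + W) : M :=
  match x with inl i => a i | inr j => b j end.

(** The first variable becomes the [None] that [All] binds, and the other [n] move down by one. *)
Definition shift_var (n : nat) (W : Type) (x : 'I_n.+1 + W) : option ('I_n + W) :=
  match x with
  | inl i => omap inl (unlift ord0 i)
  | inr w => Some (inr w)
  end.

Definition drop_var (W : Type) (x : 'I_0 + W) : W :=
  match x with
  | inl i => match notF (ltn_ord i) return W with end
  | inr w => w
  end.

Fixpoint foralls (n : nat) (W : Type) : formula L ('I_n + W) -> formula L W :=
  match n with
  | 0 => frename (@drop_var W)
  | m.+1 => fun p => foralls (All (frename (@shift_var m W) p))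
  end.

Lemma sat_foralls (M : structure L) (n : nat) (W : Type)
    (p : formula L ('I_n + W)) (v : W -> M) :
  sat (foralls p) v <-> forall a : 'I_n -> M, sat p (sumv a v).
Proof.
elim: n p => [|n IHn] p /=.
  rewrite sat_frename; have E a : v \o @drop_var W = sumv a v.
    by apply/funext => -[[]|].
  split=> [pv a|]; first by rewrite -E.
  case: (carrier_inhabited M) => x /(_ (fun=> x)).
  by rewrite -E.
rewrite IHn /=; split=> [pv a|pv a b].
  have := pv (fun i => a (lift ord0 i)) (a ord0); rewrite sat_frename.
  congr sat; apply/funext => -[i|w] //=.
  by case: unliftP => [j|] -> .
rewrite sat_frename.
have := pv (fun i => oapp a b (unlift ord0 i)); congr sat.
by apply/funext => -[i|w] //=; case: unlift.
Qed.

Lemma psatE (n : nat) (M : structure L) (p : pformula L n) (a : 'I_n -> M) b :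
  psat p a b = sat (pform p) (sumv a b).
Proof. by []. Qed.

Definition swap_sum (V W : Type) (x : V + W) : W + V :=
  match x with inl i => inr i | inr j => inl j end.

(** Makes theta(a, z) an instance in the variables z with parameters a. *)
Definition pswap (n : nat) (p : pformula L n) : pformula L (plen p) :=
  PFormula (frename (@swap_sum _ _) (pform p)).

Lemma psat_pswap (M : structure L) (n : nat) (p : pformula L n) (a : 'I_n -> M)
    (b : 'I_(plen p) -> M) : psat (pswap p) b a <-> psat p a b.
Proof.
rewrite !psatE sat_frename.
by rewrite (_ : sumv b a \o _ = sumv a b) //; apply/funext => -[].
Qed.

(** Makes the condition that theta(x, z) implies phi(x, c) an instance in the variables z with
    parameters c. *)
Definition pimplies (n : nat) (p q : pformula L n) : pformula L (plen p) :=
  PFormula (foralls (Imp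
    (frename (sumv inl (inr \o inl)) (pform p))
    (frename (sumv inl (inr \o inr)) (pform q)))).

Lemma psat_pimplies (M : structure L) (n : nat) (p q : pformula L n)
    (b : 'I_(plen p) -> M) (c : 'I_(plen q) -> M) :
  psat (pimplies p q) b c <-> forall a, psat p a b -> psat q a c.
Proof.
rewrite psatE sat_foralls /=.
have E1 a : sumv a (sumv b c) \o sumv inl (inr \o inl) = sumv a b.
  by apply/funext => -[].
have E2 a : sumv a (sumv b c) \o sumv inl (inr \o inr) = sumv a c.
  by apply/funext => -[].
by split=> pq a; have := pq a; rewrite !sat_frename E1 E2.
Qed.

(** Variable-free formulas that serve as numerals inside codes. *)
Definition num_formula (k : nat) : formula L nat := iter k (@Neg L nat) Fals.

Lemma num_formula_inj : injective num_formula.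
Proof. by elim=> [|k IHk] [|l] //= [/IHk->]. Qed.

Definition code_var (n k : nat) (x : 'I_n + 'I_k) : nat :=
  match x with inl i => i.*2 | inr j => j.*2.+1 end.

Lemma code_var_inj n k : injective (@code_var n k).
Proof.
move=> [i|i] [j|j] /= e; try by have := congr1 odd e; rewrite /= !odd_double.
  by congr inl; apply/val_inj/double_inj.
by congr inr; apply/val_inj/double_inj; case: e.
Qed.

(** One formula in v_0, v_1, ... for the pair of [p] and [j], so that there are at most |T| such
    pairs. The length is recorded because the type of [pform p] depends on it. *)
Definition code_pformula (n : nat) (p : pformula L n) (j : nat) : formula L nat :=
  Imp (num_formula j) (Imp (num_formula (plen p)) (frename (@code_var _ _) (pform p))).

Lemma code_pformula_inj (n : nat) (p q : pformula L n) (i j : nat) :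
  code_pformula p i = code_pformula q j -> p = q /\ i = j.
Proof.
case: p q => k p [l q] [/num_formula_inj-> /num_formula_inj /= kl].
by case: _ / kl q => q /(frename_inj (@code_var_inj _ _)) ->.
Qed.

End Formulas.

Lemma ord_upper_bound (T : Type) (R : rel T) (t0 : T) (m : nat) (f : 'I_m -> T) :
  total R -> transitive R -> exists k, forall j, R (f j) k.
Proof.
move=> Rtot Rtrans; elim: m f => [|m IHm] f; first by exists t0 => -[].
have [k kP] := IHm (fun j => f (lift ord0 j)).
have [fk|kf] := orP (Rtot (f ord0) k).
  by exists k => j; case: (unliftP ord0 j) => [l|] ->.
exists (f ord0) => j; case: (unliftP ord0 j) => [l|] ->.
  exact: Rtrans kf.
by have := Rtot (f ord0) (f ord0); rewrite orbb.
Qed.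

(** * One parameter for infinitely many conditions *)

Section UniformParameter.
Variables (L : language) (M : structure L).

Lemma sub_consistent (n : nat) (r r' : set (instance n M)) :
  r `<=` r' -> consistent r' -> consistent r.
Proof.
by move=> rr' [N [f [a [fel ar]]]]; exists N, f, a; split=> // i /rr'; exact: ar.
Qed.

(** The identity of [M] is an elementary embedding, so consequence can be tested in [M] itself. *)
Lemma entails_realizes (n : nat) (q r : set (instance n M)) (a : 'I_n -> M) :
  entails q r -> realizes a q -> realizes a r.
Proof. by apply. Qed.

(* The b_(phi, k) of the header, with r the phi-part of p_k and E the set of
   the a_j for j >= k in C. *)
Lemma ex_uniform_parameter (mu : cardinal) (n : nat) (phi theta : pformula L n) :
  saturated mu M ->
  (forall r : set (instance n M),
     is_type [set phi] [set: M] r -> finite_set r ->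
   forall A : set ('I_n -> M),
     finite_set A -> (forall a, A a -> realizes a r) ->
   exists b : 'I_(plen theta) -> M,
     (forall a, A a -> psat theta a b) /\ entails [set Inst theta b] r) ->
  forall (C : set M) (r : set (instance n M)) (E : set ('I_n -> M)),
  is_type [set phi] C r -> (forall a, E a -> realizes a r) ->
  card_lt (C `|` [set x | exists2 a, E a & exists k, x = a k]) [set: mu] ->
  exists b : 'I_(plen theta) -> M,
    (forall a, E a -> psat theta a b) /\
    (forall i, r i -> forall a, psat theta a b -> psat (tag i) a (tagged i)).
Proof.
move=> Msat Htheta C r E [rphi rcons] Er small.
(* All conditions on z together; a realization of [q] is the required parameter. *)
pose q : set (instance (plen theta) M) := [set i |
  (exists2 a, E a & i = Inst (pswap theta) a) \/
  (exists2 j, r j & i = Inst (pimplies theta (tag j)) (tagged j))].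
have [|b bq] := Msat _ _ q small; last 1 first.
- exists b; split=> [a Ea|i ri].
    by apply/psat_pswap; apply: (bq (Inst (pswap theta) a)); left; exists a.
  apply/psat_pimplies.
  by apply: (bq (Inst (pimplies theta (tag i)) (tagged i))); right; exists i.
split.
  move=> i [[a Ea ->]|[j rj ->]]; split=> // k /=; first by right; exists a => //; exists k.
  by left; have [_] := rphi j rj; exact.
apply: finitely_satisfiable_consistent => s sq.
(* The list [s] involves finitely many elements of [E] and of [r]; the hypothesis on theta applies
   to these. *)
have [r0 [E0 [[r0fin r0r] [E0fin E0E] s0]]] : exists (r0 : set (instance n M))
    (E0 : set ('I_n -> M)), [/\ finite_set r0 /\ r0 `<=` r,
      finite_set E0 /\ E0 `<=` E &
      forall b : 'I_(plen theta) -> M,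
        (forall a, E0 a -> psat theta a b) ->
        (forall i, r0 i -> forall a, psat theta a b -> psat (tag i) a (tagged i)) ->
        forall i, List.In i s -> psat (tag i) b (tagged i)].
  elim: s sq => [|i s IHs] sq.
    by exists set0, set0; split=> //; split=> //; exact: finite_set0.
  have [|r0 [E0 [[r0fin r0r] [E0fin E0E] s0]]] := IHs.
    by move=> j js; apply: sq; right.
  have [[a Ea ei]|[j rj ei]] := sq i (or_introl erefl).
  - exists r0, (a |` E0); split=> //.
      split; first by rewrite finite_setU.
      by move=> x [->|/E0E].
    move=> b bE br k [<-|ks]; last by apply: s0 ks => // x E0x; apply: bE; right.
    by rewrite ei; apply/psat_pswap/bE; left.
  - exists (j |` r0), E0; split=> //.
      split; first by rewrite finite_setU.
      by move=> x [->|/r0r].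
    move=> b bE br k [<-|ks]; last by apply: s0 ks => // x r0x; apply: br; right.
    by rewrite ei; apply/psat_pimplies/br; left.
have [|//|//||b [bE br]] := Htheta r0 _ _ E0.
- split; last exact: sub_consistent rcons.
  by move=> i /r0r/rphi[].
- by move=> a /E0E/Er ar i /r0r/ar.
exists b; apply: s0 => // i r0i a ab.
by apply: (entails_realizes br) => // _ ->.
Qed.

End UniformParameter.

(** * Realizing the type along a cofinal set *)

Theorem lemma5p3 (L : language) (T : set (sentence L)) (n : nat)
    (Delta : set (pformula L n)) :
  complete_theory T ->
  (forall phi : pformula L n, Delta phi ->
   exists theta : pformula L n,
   forall M : structure L, models M T ->
   forall r : set (instance n M),
     is_type [set phi] [set: M] r -> finite_set r ->
   forall A : set ('I_n -> M),
     finite_set A -> (forall a, A a -> realizes a r) ->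
   exists b : 'I_(plen theta) -> M,
     (forall a, A a -> psat theta a b) /\ entails [set Inst theta b] r) ->
  singular_compactness T Delta.
Proof.
move=> _ Htheta M mu MT [muinf [C [Ccof Clt]]] Llt Msat A p Amu [pDA pcons].
have [k0 _] := infinite_setN0 muinf.
have ctot := well_order_total (cle_wo (c := mu)).
have canti := well_order_anti (cle_wo (c := mu)).
have ctrans := well_order_trans (cle_wo (c := mu)).
have [g [_ ginj]] := card_le_exfun k0 Amu.
(* The A_k of the header, with [g] indexing the elements of [A] by points of [mu]. *)
pose B (k : mu) : set M := [set x | A x /\ cle (g x) k].
have Blt k : card_lt (B k) [set: mu].
  (* [cle_initial] bounds the open segment below [k]; the point [k] is added separately. *)
  apply: card_lt_le_trans (card_lt_setU muinf (cle_initial k)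
    (card_lt_finite (finite_set1 k) muinf)).
  apply: (@card_le_rel _ _ _ _ (fun x j => A x /\ j = g x)).
    move=> x [Ax gxk]; exists (g x) => //.
    have [kgx|] := boolP (cle k (g x)); last by left.
    by right; apply: canti; rewrite gxk kgx.
  by move=> x x' j _ _ [Ax ->] [Ax'] /ginj; exact.
pose r k : set (instance n M) := [set i | p i /\ forall j, B k (tagged i j)].
have r_le j k : cle j k -> r j `<=` r k.
  move=> jk i [pi Bi]; split=> // l; have [Al gl] := Bi l.
  by split=> //; exact: ctrans gl jk.
have rcons k : consistent (r k) by apply: sub_consistent pcons => i [].
have /choice[a aP] k : exists a : 'I_n -> M, realizes a (r k).
  apply: (Msat n (B k)) => //; split=> // i [pi Bi]; split=> //.
(* Here theta depends on phi alone; outside [Delta] the value [phi] is a dummy. *)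
have /choice[theta thetaP] (phi : pformula L n) : exists theta : pformula L n,
    Delta phi -> forall r : set (instance n M),
     is_type [set phi] [set: M] r -> finite_set r ->
   forall A : set ('I_n -> M),
     finite_set A -> (forall a, A a -> realizes a r) ->
   exists b : 'I_(plen theta) -> M,
     (forall a, A a -> psat theta a b) /\ entails [set Inst theta b] r.
  have [/Htheta[theta th]|nD] := pselect (Delta phi); last by exists phi.
  by exists theta => _; exact: th.
have coords (E : set ('I_n -> M)) : E `<=` a @` C ->
    card_lt [set x | exists2 e, E e & exists i, x = e i] [set: mu].
  move=> EC; apply: card_lt_le_trans (card_lt_setX muinf Clt
    (card_lt_finite (finite_finset (X := [set: 'I_n])) muinf)).
  apply: (@card_le_rel _ _ _ _ (fun x q => x = a q.1 q.2)).
    by move=> x [e /EC[k Ck <-] [i ->]]; exists (k, i).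
  by move=> x x' q _ _ -> ->.
have bex (phi : pformula L n) k : exists b : 'I_(plen (theta phi)) -> M, Delta phi ->
    (forall j, C j -> cle k j -> psat (theta phi) (a j) b) /\
    (forall i, r k i -> tag i = phi -> forall e,
      psat (theta phi) e b -> psat (tag i) e (tagged i)).
  have [Dphi|nD] := pselect (Delta phi); last first.
    by case: (carrier_inhabited M) => x; exists (fun=> x).
  (* As [r] is increasing, each a_j with j >= k realizes the phi-part of [r k]. *)
  pose E := [set e | exists2 j, C j /\ cle k j & e = a j].
  have [| | |b [bE br]] := ex_uniform_parameter Msat (thetaP phi Dphi) (C := B k)
      (r := [set i | r k i /\ tag i = phi]) (E := E).
  - split; last by apply: sub_consistent (rcons k) => i [].
    by move=> i [[_ Bi] ei].
  - by move=> _ [j [_ kj] ->] i [/(r_le _ _ kj) ri _]; exact: (aP j).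
  - apply: card_lt_setU => //; apply: coords => _ [j [Cj _] ->]; by exists j.
  exists b => _; split=> [j Cj kj|i ri ei]; last exact: br.
  by apply: bE; exists j.
pose b phi k := sval (cid (bex phi k)).
have bP phi k : Delta phi ->
    (forall j, C j -> cle k j -> psat (theta phi) (a j) (b phi k)) /\
    (forall i, r k i -> tag i = phi -> forall e,
      psat (theta phi) e (b phi k) -> psat (tag i) e (tagged i)).
  exact: svalP (cid (bex phi k)).
pose q : set (instance n M) := [set i | exists phi k,
  [/\ Delta phi, C k & i = Inst (theta phi) (b phi k)]].
pose D : set M := [set x | exists phi k,
  [/\ Delta phi, C k & exists j, x = b phi k j]].
(* The element [b phi k j] is determined by the code of [phi] and [j] together with [k] in [C]; both
   |T| and |C| are below [mu]. *)
have Dlt : card_lt D [set: mu].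
  apply: card_lt_le_trans (card_lt_setX muinf Llt Clt).
  apply: (@card_le_rel _ _ _ _ (fun x t => exists (phi : pformula L n) k
      (j : 'I_(plen (theta phi))), t = (code_pformula phi j, k) /\ x = b phi k j)).
    move=> x [phi [k [_ Ck [j xE]]]]; exists (code_pformula phi j, k) => //.
    by exists phi, k, j.
  move=> x x' _ _ _ [phi [k [j [-> ->]]]] [phi' [k' [j' [te ->]]]].
  have [ee] := code_pformula_inj (congr1 fst te).
  have /= -> := congr1 snd te.
  by case: _ / ee j' {te} => j' /val_inj ->.
have [e eq] : exists e : 'I_n -> M, realizes e q.
  apply: (Msat n D) => //; split.
    by move=> i [phi [k [Dphi Ck ->]]]; split=> // j; exists phi, k; split=> //; exists j.
  apply: finitely_satisfiable_consistent => s sq.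
  (* With [k] in [C] above all the indices occurring in [s], the tuple [a k] satisfies the whole
     list. *)
  have [k [Ck ks]] : exists k, C k /\ forall i, List.In i s ->
      exists phi k', [/\ Delta phi, cle k' k & i = Inst (theta phi) (b phi k')].
    elim: s sq => [|i s IHs] sq.
      by have [k Ck _] := Ccof k0; exists k.
    have [|k [Ck ks]] := IHs; first by move=> j js; apply: sq; right.
    have [phi [k' [Dphi Ck' ei]]] := sq i (or_introl erefl).
    have [kk'|k'k] := orP (ctot k k').
      exists k'; split=> // j [<-|/ks[psi [l [Dpsi lk ->]]]].
        by exists phi, k'; split=> //; have := ctot k' k'; rewrite orbb.
      by exists psi, l; split=> //; exact: ctrans kk'.
    exists k; split=> // j [<-|/ks//].
    by exists phi, k'.
  exists (a k) => i /ks[phi [k' [Dphi k'k ->]]].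
  by have [bE _] := bP phi k' Dphi; exact: bE.
exists e => i pi; have [Dphi Ai] := pDA i pi.
(* An instance has finitely many parameters, so it already lies in [r k] for some [k] in [C]. *)
have [k Ck ik] : exists2 k, C k & forall j, cle (g (tagged i j)) k.
  have [k kP] := ord_upper_bound k0 (fun j => g (tagged i j)) ctot ctrans.
  have [k' Ck' kk'] := Ccof k; exists k' => // j; exact: ctrans kk'.
have [_ br] := bP (tag i) k Dphi.
have ri : r k i by [].
apply: (br i ri erefl).
by apply: (eq (Inst (theta (tag i)) (b (tag i) k))); exists (tag i), k.
Qed.
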